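(* For real $q>-1$ and $x>0$ let $$V_q(x)=\frac{2e^{x^2}}{\Gamma(q+1)}\int_x^{\infty}e^{-t^2}(t^2-x^2)^q\,dt.$$ The following assertions are true: (a) $V_q$ is strictly $(0,0)$-concave on $(0,\infty)$ for $q>-1$; (b) $V_q$ is strictly $(-1,1)$-concave on $(0,\infty)$ for $q>-1$; (c) $V_q$ is strictly $(2,1)$-convex on $(0,\infty)$ for $q\geq 0$; (d) $V_q$ is strictly $(2,0)$-convex on $(0,\infty)$ for $q\geq 0$. In particular, for all $q\geq 0$ and $x,y>0$ the inequalities $$V_q\left(\sqrt{\frac{x^2+y^2}{2}}\right)\le\sqrt{V_q(x)V_q(y)}\le V_q(\sqrt{xy})$$ and $$\frac{V_q(x)+V_q(y)}{2}\le V_q\left(\frac{2xy}{x+y}\right)$$ are valid. Moreover, the inequality $\sqrt{V_q(x)V_q(y)}\le V_q(\sqrt{xy})$ and the inequality $\frac{V_q(x)+V_q(y)}{2}\le V_q\left(\frac{2xy}{x+y}\right)$ are valid for all $q>-1$ and $x,y>0$. In each of the inequalities $V_q\left(\sqrt{\frac{x^2+y^2}{2}}\right)\le\sqrt{V_q(x)V_q(y)}$ (for $q\geq 0$), $\sqrt{V_q(x)V_q(y)}\le V_q(\sqrt{xy})$ (for $q>-1$) and $\frac{V_q(x)+V_q(y)}{2}\le V_q\left(\frac{2xy}{x+y}\right)$ (for $q>-1$) equality holds if and only if $x=y$.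
   Context: $\Gamma$ denotes the Euler gamma function. For $a\in\mathbb{R}$, $\alpha\in[0,1]$ and $x,y>0$, the (weighted) power mean of order $a$ is $$H_a(x,y)=\begin{cases}\left(\alpha x^a+(1-\alpha)y^a\right)^{1/a}, & a\neq 0,\\ x^{\alpha}y^{1-\alpha}, & a=0.\end{cases}$$ Let $I\subset(0,\infty)$ be an interval and $\varphi:I\to(0,\infty)$ continuous. For $a,b\in\mathbb{R}$, $\varphi$ is called $(a,b)$-convex if $\varphi(H_a(x,y))\leq H_b(\varphi(x),\varphi(y))$ for all $x,y\in I$ and all $\alpha\in[0,1]$ (the same weight $\alpha$ is used in both means), and $(a,b)$-concave if the reversed inequality holds. It is strictly $(a,b)$-convex (respectively strictly $(a,b)$-concave) if the corresponding inequality is strict whenever $x\neq y$ and $\alpha\in(0,1)$. *)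

(* Defs.v *)
From HB Require Import structures.
From mathcomp Require Import all_boot all_order all_algebra.
From mathcomp Require Import all_classical all_reals all_analysis.

Set Implicit Arguments.
Unset Strict Implicit.
Unset Printing Implicit Defensive.

Import Order.TTheory GRing.Theory Num.Theory.
Import numFieldNormedType.Exports.

Local Open Scope classical_set_scope.
Local Open Scope ring_scope.

(* The weighted power mean of order a with weight w on x. *)
Definition power_mean {R : realType} (w a x y : R) : R :=
  if a == 0 then x `^ w * y `^ (1 - w)
  else (w * x `^ a + (1 - w) * y `^ a) `^ a^-1.

Section PowerMeanConvexity.
Context {R : realType}.

(* Functions on an interval I are total functions of which only the values on
   I matter; this predicate says that f restricts to a continuous map from I,
   contained in ]0, +oo[, to ]0, +oo[.  It is part of each convexity notion
   below. *)
Definition positive_continuous_on (I : interval R) (f : R -> R) : Prop :=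
  [/\ [set` I] `<=` [set x | 0 < x],
      (forall x, x \in I -> 0 < f x)
    & {within [set` I], continuous f}].

Definition mean_convex (I : interval R) (a b : R) (f : R -> R) : Prop :=
  positive_continuous_on I f /\
  forall x y w, x \in I -> y \in I -> 0 <= w <= 1 ->
    f (power_mean w a x y) <= power_mean w b (f x) (f y).

Definition mean_concave (I : interval R) (a b : R) (f : R -> R) : Prop :=
  positive_continuous_on I f /\
  forall x y w, x \in I -> y \in I -> 0 <= w <= 1 ->
    power_mean w b (f x) (f y) <= f (power_mean w a x y).

Definition strictly_mean_convex (I : interval R) (a b : R) (f : R -> R) : Prop :=
  mean_convex I a b f /\
  forall x y w, x \in I -> y \in I -> x != y -> 0 < w < 1 ->
    f (power_mean w a x y) < power_mean w b (f x) (f y).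

Definition strictly_mean_concave (I : interval R) (a b : R) (f : R -> R) : Prop :=
  mean_concave I a b f /\
  forall x y w, x \in I -> y \in I -> x != y -> 0 < w < 1 ->
    power_mean w b (f x) (f y) < f (power_mean w a x y).

End PowerMeanConvexity.

(* Euler's integral; it represents the gamma function for 0 < s only. *)
Definition Gamma {R : realType} (s : R) : R :=
  \int[lebesgue_measure]_(t in `]0, +oo[) (t `^ (s - 1) * expR (- t)).

(* The domain of integration is open at x because the integrand is singular
   there when q < 0. Rintegral sends an infinite integral to 0, so the
   positivity of V q x entails that the integral is finite. *)
Definition V {R : realType} (q x : R) : R :=
  2 * expR (x ^+ 2) / Gamma (q + 1) *
  \int[lebesgue_measure]_(t in `]x, +oo[)
     (expR (- t ^+ 2) * (t ^+ 2 - x ^+ 2) `^ q).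

(* Main.v *)
Require Import Defs.
From HB Require Import structures.
From mathcomp Require Import all_boot all_order all_algebra.
From mathcomp Require Import all_classical all_reals all_analysis.
From mathcomp Require Import measurable_realfun ring lra.
Import Order.TTheory GRing.Theory Num.Theory.
Import numFieldNormedType.Exports.
Local Open Scope classical_set_scope.
Local Open Scope ring_scope.

(** The substitution [t = sqrt (x ^+ 2 + s)] turns [V q x] into the value at
    [u = x ^+ 2] of
<<
      J(u) = \int_0^oo s^q e^(-s) / sqrt (u + s) ds
>>
    divided by [Gamma (q + 1)] (lemma [V_invsqrt_integral]); here the weight
    [s^q e^(-s)] is positive and integrable because [-1 < q].  Strict pointwise
    inequalities between kernels then integrate to strict inequalities.

    - (d) Raising the weighted arithmetic-geometric inequality between [u + s]
      and [v + s] to the power [-1/2] shows that [(u + s)^(-1/2)] is log-convex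
      in [u].  The integrated form follows as in the proof of Hoelder's
      inequality, by a second use of the arithmetic-geometric inequality for
      the kernels divided by their integrals
      ([invsqrt_integral_log_convex]).  (c) follows from (d), since a geometric
      mean is at most the corresponding arithmetic mean.

    - (b) For fixed [s], the map [t |-> (t^(-2) + s)^(-1/2)] is strictly concave
      on the positive reals: its graph lies below its tangents
      ([tangent_sqrtV]), a polynomial inequality once squared.

    - (a) Rescaling [s] gives [J(a v) = C(a) P(v)] for [1 < a], where [P(v)] is
      the integral defining [J(v)] with the additional factor [e^(-(a - 1) s)].
      Passing from [v = u] to [v = b u] with [1 < b] reweights the measure by
      the increasing function [sqrt (u + s) / sqrt (b u + s)] of [s], whereas
      the additional factor decreases in [s]; by Chebyshev's association
      inequality [P(v) / J(v)] gets smaller, that is,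
      [J(u) J(a b u) < J(a u) J(b u)] ([invsqrt_integral_mul_lt]).  With
      [a = b] this is strict midpoint concavity of [ln (J (e^t))], and for a
      continuous function this gives strict concavity for all weights
      ([midpoint_strict_concave]).

    The displayed inequalities and their equality cases are the case of equal
    weights. *)

(** * Integration on half-lines *)

(** Equality of the integrals would make the nonnegative difference [g - f]
    vanish almost everywhere, although it is positive on the non-null set [A]. *)
Lemma lt_Rintegral d (T : measurableType d) (R : realType)
    (mu : {measure set T -> \bar R}) (D A : set T) (f g : T -> R) :
  measurable D -> mu.-integrable D (EFin \o f) -> mu.-integrable D (EFin \o g) ->
  (forall x, D x -> f x <= g x) ->
  A `<=` D -> measurable A -> (0 < mu A)%E -> (forall x, A x -> f x < g x) ->
  \int[mu]_(x in D) f x < \int[mu]_(x in D) g x.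
Proof.
move=> mD fi gi fg AD mA A0 fgA.
rewrite lt_neqAle le_Rintegral// andbT -subr_eq0 -opprB oppr_eq0 -RintegralB//.
apply/eqP => eq0.
have gfi : mu.-integrable D (EFin \o (g \- f)).
  have := integrableB mD gi fi; apply: eq_integrable => // x _.
have abs0 : (\int[mu]_(x in D) `|(EFin \o (g \- f)%R) x| = 0)%E.
  have -> : (\int[mu]_(x in D) `|(EFin \o (g \- f)%R) x| =
             \int[mu]_(x in D) (g x - f x)%R%:E)%E.
    by apply: eq_integral => x; rewrite inE => Dx /=; rewrite ger0_norm// subr_ge0 fg.
  have := integrable_fin_num mD gfi; move/fineK => <-.
  by rewrite -[fine _]/(\int[mu]_(x in D) (g x - f x)) eq0.
have /(ae_eq_integral_abs mu mD) := measurable_int mu gfi.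
move=> [/(_ abs0) [N [mN N0 DN]] _].
suff : (mu A <= mu N)%E by rewrite N0 leNgt A0.
apply: le_measure; rewrite ?inE// => x Ax; apply: DN => /= /(_ (AD _ Ax)) [] /eqP.
by rewrite subr_eq0 gt_eqF// fgA.
Qed.

Lemma integrable_EFinZl d (T : measurableType d) (R : realType)
    (mu : {measure set T -> \bar R}) (D : set T) (c : R) (f : T -> R) :
  measurable D -> mu.-integrable D (EFin \o f) ->
  mu.-integrable D (EFin \o (fun x => c * f x)).
Proof. by move=> mD fi; have := integrableZl mD c fi. Qed.

Lemma integrable_EFinD d (T : measurableType d) (R : realType)
    (mu : {measure set T -> \bar R}) (D : set T) (f g : T -> R) :
  measurable D -> mu.-integrable D (EFin \o f) -> mu.-integrable D (EFin \o g) ->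
  mu.-integrable D (EFin \o (fun x => f x + g x)).
Proof. by move=> mD fi gi; have := integrableD mD fi gi. Qed.

Lemma integrable_EFinB d (T : measurableType d) (R : realType)
    (mu : {measure set T -> \bar R}) (D : set T) (f g : T -> R) :
  measurable D -> mu.-integrable D (EFin \o f) -> mu.-integrable D (EFin \o g) ->
  mu.-integrable D (EFin \o (fun x => f x - g x)).
Proof. by move=> mD fi gi; have := integrableB mD fi gi. Qed.

Lemma continuous_oy_measurable (R : realType) (h : R -> R) (c : R) :
  {in `]c, +oo[, continuous h} -> measurable_fun `]c, +oo[ h.
Proof.
move=> ch; apply: open_continuous_measurable_fun; first exact: interval_open.
by move=> x; rewrite inE; exact: ch.
Qed.

(** Gives access to integrands that are unbounded at the left endpoint [c]
    through their integrals over closed half-lines. *)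
Lemma cvg_integral_itvcy (R : realType) (f : R -> R) (c : R) (c_ : nat -> R) :
  measurable_fun `]c, +oo[ f -> (forall x, c < x -> 0 <= f x) ->
  nonincreasing_seq c_ -> (forall n, c < c_ n) -> c_ n @[n --> \oo] --> c ->
  (\int[lebesgue_measure]_(x in `[c_ n, +oo[) (f x)%:E)%E @[n --> \oo] -->
  (\int[lebesgue_measure]_(x in `]c, +oo[) (f x)%:E)%E.
Proof.
move=> mf f0 c_dec c_gt c_cvg.
have -> : `]c, +oo[%classic = \bigcup_n `[c_ n, +oo[%classic.
  apply/seteqP; split=> x /=; rewrite in_itv/= andbT.
    move=> cx; have [N _ HN] := cvgr_le _ c_cvg _ cx.
    by exists N => //=; rewrite in_itv/= andbT; apply: HN => /=.
  by move=> [n _] /=; rewrite in_itv/= andbT; apply: lt_le_trans.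
have sub n : `[c_ n, +oo[%classic `<=` `]c, +oo[%classic.
  by apply: subset_itvr; rewrite bnd_simp.
apply: ge0_nondecreasing_set_cvg_integral => //.
- move=> m n mn; rewrite subsetEset; apply: subset_itvr.
  by rewrite bnd_simp; exact: c_dec.
- move=> n; apply/measurable_EFinP; apply: measurable_funS mf => //; exact: sub.
- by move=> n x /sub /=; rewrite in_itv/= andbT lee_fin; exact: f0.
Qed.

(** Only continuity on the open half-line is asked of the integrand [G], which
    may therefore be singular at [F a]: the formula on closed half-lines passes
    to the limit along [a + 1 / n.+1]. *)
Lemma integration_by_substitution_itvoy (R : realType) (F f G : R -> R) (a : R) :
  {in `[a, +oo[ &, {homo F : x y / x < y}} ->
  (forall x, a < x -> is_derive x 1 F (f x)) -> {in `]a, +oo[, continuous f} ->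
  cvg (f x @[x --> +oo]) ->
  F x @[x --> a^'+] --> F a -> F x @[x --> +oo] --> +oo ->
  {in `]F a, +oo[, continuous G} -> (forall y, F a < y -> 0 <= G y) ->
  (\int[lebesgue_measure]_(y in `]F a, +oo[) (G y)%:E =
   \int[lebesgue_measure]_(x in `]a, +oo[) (G (F x) * f x)%:E)%E.
Proof.
move=> Finc dF cf fy Fa Fy cG G0.
have dFE x : a < x -> derive1 F x = f x.
  by move=> ax; rewrite derive1E; have h := dF _ ax; exact: derive_val.
have Fa_lt x : a < x -> F a < F x.
  by move=> ax; apply: Finc; rewrite ?in_itv/= ?lexx ?andbT//= ltW.
have cF : {in `]a, +oo[, continuous F}.
  move=> x; rewrite in_itv/= andbT => ax.
  by apply/differentiable_continuous/derivable1_diffP/ex_derive/dF.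
have cF' x : a < x -> {for x, continuous (derive1 F)}.
  move=> ax; rewrite /prop_for /continuous_at dFE//.
  have := cf x; rewrite in_itv/= andbT => /(_ ax).
  apply: cvg_trans; apply: near_eq_cvg.
  near=> z; rewrite dFE//; near: z; exact: lt_nbhsr.
have f0 x : a < x -> 0 <= f x.
  move=> ax; rewrite -dFE//.
  apply: (@incr_derive1_ge0_itvy _ _ false a).
  - move=> z; rewrite inE/= in_itv/= andbT => az; exact/ex_derive/dF.
  - move=> x1 x2; rewrite !in_itv/= !andbT => /ltW h1 /ltW h2.
    by apply: Finc; rewrite in_itv/= andbT.
  - by rewrite in_itv/= andbT.
pose a_ n : R := a + n.+1%:R^-1.
have a_gt n : a < a_ n by rewrite ltrDl invr_gt0.
have a_cvg : a_ n @[n --> \oo] --> a.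
  rewrite -[X in _ --> X]addr0; apply: cvgD; first exact: cvg_cst.
  exact: cvg_harmonic.
have a_dec : nonincreasing_seq a_.
  by move=> m n mn; rewrite lerD2l lef_pV2 ?posrE// ler_nat.
have Fa_cvg : F (a_ n) @[n --> \oo] --> F a.
  have := cvg_at_rightP F a (F a).
  by move=> [+ _] => /(_ Fa); apply; split.
have cGF : {in `]a, +oo[, continuous (fun x => G (F x) * f x)}.
  move=> x; rewrite in_itv/= andbT => ax; apply: continuousM.
    apply: continuous_comp; first by apply: cF; rewrite in_itv/= andbT.
    by apply: cG; rewrite in_itv/= andbT Fa_lt.
  by apply: cf; rewrite in_itv/= andbT.
have L := @cvg_integral_itvcy _ G (F a) (F \o a_) (continuous_oy_measurable _ _ _ cG) G0.
have {}L : (\int[lebesgue_measure]_(x in `[(F (a_ n)), +oo[) (G x)%:E)%E @[n --> \oo] -->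
  (\int[lebesgue_measure]_(x in `](F a), +oo[) (G x)%:E)%E.
  apply: L => //.
  - move=> m n mn /=; have := a_dec _ _ mn.
    rewrite le_eqVlt => /predU1P[->//|h]; apply: ltW; apply: Finc => //;
      by rewrite in_itv/= andbT ltW.
  - by move=> n /=; exact: Fa_lt.
have M := @cvg_integral_itvcy _ (fun x => G (F x) * f x) a a_ (continuous_oy_measurable _ _ _ cGF).
have {}M := M (fun x ax => mulr_ge0 (G0 _ (Fa_lt _ ax)) (f0 _ ax)) a_dec a_gt a_cvg.
apply: (cvg_unique (@ereal_hausdorff R) L).
apply: cvg_trans M; apply: near_eq_cvg; near=> n => /=.
rewrite (@increasing_ge0_integration_by_substitutiony _ F G (a_ n)).
- apply: eq_integral => x; rewrite inE/= in_itv/= andbT => ax.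
  by rewrite !fctE dFE// (lt_le_trans (a_gt n)).
- move=> x y; rewrite !in_itv/= !andbT => hx hy.
  by apply: Finc; rewrite in_itv/= andbT (le_trans (ltW (a_gt n))).
- move=> x; rewrite in_itv/= andbT => hx; apply: cF'; exact: lt_trans hx.
- apply/cvg_ex; exists (derive1 F (a_ n)); apply: cvg_at_right_filter.
  exact: cF'.
- move/cvg_ex: fy => [l fl]; apply/cvg_ex; exists l.
  apply: cvg_trans fl; apply: near_eq_cvg; near=> z; rewrite dFE//.
  near: z; apply: nbhs_pinfty_gt; exact: num_real.
- split.
    move=> x; rewrite in_itv/= andbT => hx; apply/ex_derive/dF.
    exact: lt_trans hx.
  by apply: cvg_at_right_filter; apply: cF; rewrite in_itv/= andbT.
- exact: Fy.
- apply/continuous_within_itvcyP; split.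
    move=> x; rewrite in_itv/= andbT => hx; apply: cG; rewrite in_itv/= andbT.
    by apply: lt_trans hx; exact: Fa_lt.
  by apply: cvg_at_right_filter; apply: cG; rewrite in_itv/= andbT Fa_lt.
- move=> x; rewrite in_itv/= andbT => hx; apply: G0; apply: lt_trans hx.
  exact: Fa_lt.
Unshelve. all: end_near. Qed.

(** * The gamma weight *)

Section gamma_weight.
Context {R : realType}.
Implicit Types q s : R.
Local Notation mu := (@lebesgue_measure R).

Definition gamma_weight q s : R := s `^ q * expR (- s).

Lemma gamma_weight_gt0 q s : 0 < s -> 0 < gamma_weight q s.
Proof. by move=> s0; rewrite mulr_gt0 ?powR_gt0 ?expR_gt0. Qed.

Lemma continuous_powR q : {in `]0, +oo[, continuous (fun s : R => s `^ q)}.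
Proof.
by move=> s s0; apply/differentiable_continuous/derivable1_diffP/derivable_powR.
Qed.

Lemma continuous_gamma_weight q : {in `]0, +oo[, continuous (gamma_weight q)}.
Proof.
move=> s s0; rewrite /gamma_weight; apply: (@cvgM R); first exact: continuous_powR.
apply: continuous_comp; first exact: opp_continuous.
exact: continuous_expR.
Qed.

(** The inequality [ln y <= y - 1] at [y = (1 + s) / p]. *)
Lemma powR_1D_le_expR (p s : R) : 0 < p -> 0 < s ->
  (1 + s) `^ p <= expR (p * ln p + 1 - p) * expR s.
Proof.
move=> p0 s0; have s1 : 0 < 1 + s by rewrite addr_gt0.
rewrite /powR gt_eqF// -expRD ler_expR.
have -> : ln (1 + s) = ln p + ln (1 + ((1 + s) / p - 1)).
  by rewrite [1 + (_ - 1)]addrC subrK -lnM ?posrE ?divr_gt0// mulrC divfK// gt_eqF.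
rewrite mulrDr -!addrA lerD2l.
rewrite (@le_trans _ _ (p * ((1 + s) / p - 1)))//.
  by rewrite ler_pM2l//; apply: le_ln1Dx; rewrite ltrBrDr addNr divr_gt0.
by rewrite mulrBr mulrCA divff ?gt_eqF//; lra.
Qed.

(** The weight is dominated by a multiple of
    [(q + 1) s^q (1 + s)^(-(q + 2))], whose primitive [(s / (1 + s))^(q + 1)]
    is bounded by [1]; this treats the singularity at [0] and the decay at
    infinity at once. *)
Lemma integrable_gamma_weight q : -1 < q ->
  mu.-integrable `]0, +oo[ (EFin \o gamma_weight q).
Proof.
move=> q1; have q10 : 0 < q + 1 by lra.
(* H is the bounded primitive of the dominating function h *)
pose H (s : R) := s `^ (q + 1) * (1 + s) `^ (- (q + 1)).
pose h (s : R) := (q + 1) * s `^ q * (1 + s) `^ (- (q + 2)).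
have dH s : 0 < s -> is_derive s 1 H (h s).
  move=> s0; have s1 : 0 < 1 + s by rewrite addr_gt0.
  have d1 : is_derive s 1 (fun s => 1 + s) (0 + 1) by exact: is_deriveD.
  have d2 := is_derive1_comp (is_derive1_powR (- (q + 1)) s1) d1.
  apply: is_derive_eq; first exact: (is_deriveM (is_derive1_powR (q + 1) s0) d2).
  rewrite /h /= add0r mulr1 /GRing.scale/=.
  have -> : q + 1 - 1 = q by lra.
  have -> : - (q + 1) - 1 = - (q + 2) by lra.
  have -> : s `^ (q + 1) = s `^ q * s.
    by rewrite powRD ?powRr1// ?ltW// (gt_eqF s0) implybT.
  have -> : (1 + s) `^ (- (q + 1)) = (1 + s) `^ (- (q + 2)) * (1 + s).
    have -> : - (q + 1) = - (q + 2) + 1 by lra.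
    by rewrite powRD ?(powRr1 (ltW s1))// (gt_eqF s1) implybT.
  by ring.
have cH s : 0 < s -> {for s, continuous H}.
  by move=> s0; apply/differentiable_continuous/derivable1_diffP/ex_derive/dH.
have ch : {in `]0, +oo[, continuous h}.
  move=> s /[dup] s0; rewrite in_itv/= andbT => s_gt0.
  apply: (@cvgM R); first by apply: (@cvgM R); [exact: cvg_cst|exact: continuous_powR].
  apply: (@continuous_comp _ _ _ (fun s => 1 + s) (fun s => s `^ _)).
    by apply: continuousD; [exact: cvg_cst|exact: cvg_id].
  by apply: continuous_powR; rewrite in_itv/= andbT addr_gt0.
have h0 s : 0 < s -> 0 <= h s.
  by move=> s0; rewrite !mulr_ge0 ?powR_ge0// ltW.
have Hy : H s @[s --> +oo] --> (1 : R).
  have : (1 - (1 + s)^-1) `^ (q + 1) @[s --> +oo] --> (1 - 0 : R) `^ (q + 1).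
    apply: (@continuous_cvg _ _ _ _ _ (fun s => 1 - (1 + s)^-1) (fun s : R => s `^ (q + 1))).
      by apply: continuous_powR; rewrite subr0 in_itv/= andbT.
    apply: cvgB; first exact: cvg_cst.
    apply/gtr0_cvgV0; last by apply: cvg_addrl.
    by near=> s; rewrite addr_gt0.
  rewrite subr0 powR1; apply: cvg_trans; apply: near_eq_cvg; near=> s.
  have s0 : 0 < s by [].
  have s1 : 0 < 1 + s by rewrite addr_gt0.
  have -> : 1 - (1 + s)^-1 = s / (1 + s) by field; rewrite gt_eqF.
  rewrite /H powRN powRM ?invr_ge0 ?(ltW s0) ?(ltW s1)//.
  by rewrite -powR_inv1 ?(ltW s1)// -powRrM mulN1r powRN.
(* the constant of powR_1D_le_expR for the exponent q + 2 *)
pose C : R := expR ((q + 2) * ln (q + 2) + 1 - (q + 2)).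
apply: (@le_integrable _ _ _ mu _ _ _ (fun s => (C / (q + 1))%:E * (h s)%:E)%E) => //.
- apply/measurable_EFinP; apply: continuous_oy_measurable.
  exact: continuous_gamma_weight.
- move=> s /=; rewrite in_itv/= andbT => s0.
  have s1 : 0 < 1 + s by rewrite addr_gt0.
  have C0 : 0 < C / (q + 1) by rewrite divr_gt0 ?expR_gt0.
  rewrite lee_fin (gtr0_norm (gamma_weight_gt0 _ _ s0)).
  rewrite (ger0_norm (mulr_ge0 (ltW C0) (h0 _ s0))).
  rewrite /gamma_weight /h.
  rewrite (_ : C / (q + 1) * _ = s `^ q * (C * (1 + s) `^ (- (q + 2)))); last first.
    by field; rewrite gt_eqF.
  rewrite ler_pM2l ?powR_gt0// powRN expRN.
  rewrite -lef_pV2 ?posrE ?invr_gt0 ?mulr_gt0 ?invr_gt0 ?powR_gt0 ?expR_gt0//.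
  rewrite invfM !invrK ler_pdivrMl ?expR_gt0//.
  by apply: powR_1D_le_expR => //; lra.
apply: integrableZl => //; apply/integrableP; split.
  by apply/measurable_EFinP; exact: continuous_oy_measurable.
pose c_ n : R := n.+1%:R^-1.
have c0 n : 0 < c_ n by rewrite invr_gt0.
have c_dec : nonincreasing_seq c_.
  by move=> m n mn; rewrite lef_pV2 ?posrE// ler_nat.
have L := @cvg_integral_itvcy _ h 0 c_ (continuous_oy_measurable _ _ _ ch) h0 c_dec c0 (@cvg_harmonic R).
apply: (@le_lt_trans _ _ 1%E); last exact: ltry.
rewrite [leLHS](_ : _ = \int[mu]_(s in `]0%R, +oo[) (h s)%:E)%E; last first.
  by apply: eq_integral => s; rewrite inE/= in_itv/= andbT => s0; rewrite ger0_norm// h0.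
apply: (cvge_le _ L).
apply: nearW => n /=.
rewrite (@ge0_continuous_FTC2y _ h H (c_ n) 1)//.
- by rewrite -EFinB lee_fin gerBl mulr_ge0 ?powR_ge0.
- by move=> s /(lt_le_trans (c0 n)); exact: h0.
- apply/continuous_within_itvcyP; split.
    move=> s; rewrite in_itv/= andbT => /(lt_trans (c0 n)) s0.
    by apply: ch; rewrite in_itv/= andbT.
  by apply: cvg_at_right_filter; apply: ch; rewrite in_itv/= andbT.
- by move=> s /(lt_trans (c0 n)) /dH h1; apply: ex_derive.
- by apply: cvg_at_right_filter; apply: cH.
- move=> s; rewrite in_itv/= andbT => /(lt_trans (c0 n)) /dH h1.
  by rewrite derive1E; exact: derive_val.
Unshelve. all: end_near. Qed.
End gamma_weight.

(** * The representation of V as a Stieltjes-type integral *)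

Section invsqrt.
Context {R : realType}.
Implicit Types q s u x : R.
Local Notation mu := (@lebesgue_measure R).

Lemma integrable_gamma_weightM q (b : R -> R) (M : R) : -1 < q ->
  {in `]0, +oo[, continuous b} -> (forall s, 0 < s -> `|b s| <= M) ->
  mu.-integrable `]0, +oo[ (EFin \o (fun s => gamma_weight q s * b s)).
Proof.
move=> q1 cb bM.
apply: (@le_integrable _ _ _ mu _ _ _ (fun s => M%:E * (gamma_weight q s)%:E)%E) => //.
- apply/measurable_EFinP; apply: continuous_oy_measurable => s s0.
  by apply: (@cvgM R); [exact: continuous_gamma_weight|exact: cb].
- move=> s /=; rewrite in_itv/= andbT => s0.
  have k0 := gamma_weight_gt0 q _ s0.
  rewrite lee_fin normrM [leRHS]normrM mulrC ler_pM//.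
  by rewrite (le_trans (bM _ s0))// ler_norm.
by apply: integrableZl => //; exact: integrable_gamma_weight.
Qed.

Lemma continuous_sqrtVD u : 0 < u ->
  {in `]0, +oo[, continuous (fun s : R => (Num.sqrt (u + s))^-1)}.
Proof.
move=> u0 s; rewrite in_itv/= andbT => s0.
apply: (@cvgV R); first by rewrite gt_eqF// sqrtr_gt0 addr_gt0.
apply: (@continuous_comp _ _ _ (fun s => u + s) Num.sqrt).
  by apply: cvgD; [exact: cvg_cst|exact: cvg_id].
exact: sqrt_continuous.
Qed.

Lemma sqrtVD_le u s : 0 < u -> 0 < s -> `|(Num.sqrt (u + s))^-1| <= (Num.sqrt u)^-1.
Proof.
move=> u0 s0; rewrite ger0_norm ?invr_ge0 ?sqrtr_ge0//.
by rewrite lef_pV2 ?posrE ?sqrtr_gt0 ?addr_gt0// ler_sqrt ?addr_ge0 ?lerDl// ltW.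
Qed.

(** The generalized Stieltjes transform of order [1/2] of the gamma weight. *)
Definition invsqrt_integral q u : R :=
  \int[mu]_(s in `]0, +oo[) (gamma_weight q s * (Num.sqrt (u + s))^-1).

Local Notation J := invsqrt_integral.

Lemma integrable_invsqrt q u : -1 < q -> 0 < u ->
  mu.-integrable `]0, +oo[
    (EFin \o (fun s => gamma_weight q s * (Num.sqrt (u + s))^-1)).
Proof.
move=> q1 u0; apply: (integrable_gamma_weightM _ _ (Num.sqrt u)^-1) => //.
- exact: continuous_sqrtVD.
- by move=> s; exact: sqrtVD_le.
Qed.

(** Strictness on an initial segment suffices; the comparison behind Chebyshev's
    inequality has an equality at one crossing point. *)
Lemma lt_Rintegral_itv0y_near0 (f g : R -> R) (c : R) : 0 < c ->
  mu.-integrable `]0, +oo[ (EFin \o f) -> mu.-integrable `]0, +oo[ (EFin \o g) ->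
  (forall s, 0 < s -> f s <= g s) -> (forall s, 0 < s < c -> f s < g s) ->
  \int[mu]_(s in `]0, +oo[) f s < \int[mu]_(s in `]0, +oo[) g s.
Proof.
move=> c0 fi gi fg fgc; apply: (@lt_Rintegral _ _ _ mu _ `]0, c[) => //.
- by move=> s /=; rewrite in_itv/= andbT => /fg.
- exact: subset_itvl.
- have := @lebesgue_measure_itv R `]0, c[; rewrite /= lte_fin c0 => ->.
  by rewrite sube0 lte_fin.
Qed.

Lemma lt_Rintegral_itv0y (f g : R -> R) :
  mu.-integrable `]0, +oo[ (EFin \o f) -> mu.-integrable `]0, +oo[ (EFin \o g) ->
  (forall s, 0 < s -> f s < g s) ->
  \int[mu]_(s in `]0, +oo[) f s < \int[mu]_(s in `]0, +oo[) g s.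
Proof.
move=> fi gi fg; apply: (lt_Rintegral_itv0y_near0 _ _ _ ltr01) => // s.
  by move=> /fg/ltW.
by move=> /andP[/fg].
Qed.

Lemma Rintegral_itv0y_gt0 (f : R -> R) : mu.-integrable `]0, +oo[ (EFin \o f) ->
  (forall s, 0 < s -> 0 < f s) -> 0 < \int[mu]_(s in `]0, +oo[) f s.
Proof.
move=> fi f0; have := @lt_Rintegral_itv0y (cst 0) f (integrable0 _ _) fi f0.
by rewrite Rintegral_cst// mul0r.
Qed.

Lemma invsqrt_integral_gt0 q u : -1 < q -> 0 < u -> 0 < J q u.
Proof.
move=> q1 u0; apply: Rintegral_itv0y_gt0; first exact: integrable_invsqrt.
move=> s s0; rewrite mulr_gt0 ?gamma_weight_gt0// invr_gt0 sqrtr_gt0 addr_gt0//.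
Qed.

Lemma Gamma_gt0 q : -1 < q -> 0 < Gamma (q + 1).
Proof.
move=> q1; rewrite /Gamma addrK.
apply: Rintegral_itv0y_gt0; first exact: integrable_gamma_weight.
by move=> s; exact: gamma_weight_gt0.
Qed.

(** The substitution [t = sqrt (x ^+ 2 + s)] absorbs the factor
    [expR (x ^+ 2)] and moves the singularity of the integrand to [s = 0]. *)
Lemma V_invsqrt_integral q x : -1 < q -> 0 < x -> V q x = J q (x ^+ 2) / Gamma (q + 1).
Proof.
move=> q1 x0; rewrite /V mulrAC; congr (_ / _).
have xs (s : R) : 0 <= s -> 0 < x ^+ 2 + s.
  by move=> s0; rewrite ltr_pwDl// exprn_gt0.
pose F (s : R) : R := Num.sqrt (x ^+ 2 + s).
pose f (s : R) : R := (2 * F s)^-1.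
pose G (t : R) : R := expR (- t ^+ 2) * (t ^+ 2 - x ^+ 2) `^ q.
have F0 : F 0 = x by rewrite /F addr0 sqrtr_sqr gtr0_norm.
have cF : continuous F.
  move=> s; apply: (@continuous_comp _ _ _ (fun s => x ^+ 2 + s) Num.sqrt).
    by apply: cvgD; [exact: cvg_cst|exact: cvg_id].
  exact: sqrt_continuous.
have Fy : F s @[s --> +oo] --> +oo.
  apply/cvgryPge => A; near=> s.
  rewrite (le_trans (ler_norm A))// -sqrtr_sqr ler_wsqrtr//.
  by rewrite (@le_trans _ _ s)// lerDr sqr_ge0.
have dF s : 0 < s -> is_derive s 1 F (f s).
  move=> s0; have Fs := xs _ (ltW s0).
  have d1 : is_derive s 1 (fun s => x ^+ 2 + s) (0 + 1) by exact: is_deriveD.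
  apply: is_derive_eq; first exact: (is_derive1_comp (is_derive1_sqrt Fs) d1).
  by rewrite add0r mulr1.
have Finc : {in `[0, +oo[ &, {homo F : s t / s < t}}.
  move=> s t; rewrite !in_itv/= !andbT => s0 t0 st.
  by rewrite /F ltr_sqrt ?xs// ltrD2l.
have H := @integration_by_substitution_itvoy R F f G 0 Finc dF.
rewrite [X in _ * X](_ : _ = fine (\int[mu]_(t in `]F 0%R, +oo[) (G t)%:E)%E); last by rewrite F0.
rewrite H.
- have -> : (\int[mu]_(s in `]0%R, +oo[) (G (F s) * f s)%R%:E =
    \int[mu]_(s in `]0%R, +oo[) ((expR (- x ^+ 2) / 2) * (gamma_weight q s * (Num.sqrt (x ^+ 2 + s))^-1))%R%:E)%E.
    apply: eq_integral => s; rewrite inE/= in_itv/= andbT => s0; congr EFin.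
    have Fs := xs _ (ltW s0).
    rewrite /G /f /F sqr_sqrtr ?ltW// addrAC subrr add0r opprD expRD /gamma_weight.
    by field; rewrite gt_eqF ?sqrtr_gt0.
  rewrite -/(Rintegral _ _ _) RintegralZl//; last by apply: integrable_invsqrt; rewrite ?exprn_gt0.
  by rewrite /J expRN; field; rewrite gt_eqF ?expR_gt0.
- move=> s; rewrite in_itv/= andbT => s0; apply: (@cvgV R).
    by rewrite mulf_neq0// gt_eqF// sqrtr_gt0 xs// ltW.
  by apply: (@cvgM R); [exact: cvg_cst|exact: cF].
- apply/cvg_ex; exists 0; apply/gtr0_cvgV0.
    by near=> s; rewrite mulr_gt0// sqrtr_gt0 xs.
  by apply: gt0_cvgMry => //; exact: Fy.
- exact: cvg_at_right_filter (cF 0).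
- exact: Fy.
- move=> t; rewrite F0 in_itv/= andbT => xt; apply: (@cvgM R).
    apply: continuous_comp; last exact: continuous_expR.
    by apply: cvgN; exact: exprn_continuous.
  apply: (@continuous_comp _ _ _ (fun t : R => t ^+ 2 - x ^+ 2) (fun z : R => z `^ q)).
    by apply: cvgB; [exact: exprn_continuous|exact: cvg_cst].
  by apply: continuous_powR; rewrite in_itv/= andbT subr_gt0 ltrXn2r// ltW.
- by move=> t _; rewrite mulr_ge0 ?expR_ge0 ?powR_ge0.
Unshelve. all: end_near. Qed.

Lemma continuous_invsqrt_integral q : -1 < q -> {in `]0, +oo[, continuous (J q)}.
Proof.
move=> q1 u; rewrite in_itv/= andbT => u0.
have hu : 0 < u / 2 by rewrite divr_gt0.
apply: (@continuity_under_integral R _ _ mu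
  (fun u s => gamma_weight q s * (Num.sqrt (u + s))^-1) _ _ (u / 2) (u + 1) _ _
  (fun s => gamma_weight q s * (Num.sqrt (u / 2))^-1)).
- by [].
- move=> v /=; rewrite in_itv/= => /andP[v0 _]; apply: integrable_invsqrt => //.
  exact: lt_trans v0.
- apply: aeW => s /=; rewrite in_itv/= andbT => s0 v; rewrite inE/= in_itv/= => /andP[v0 _].
  apply: (@cvgM R); first exact: cvg_cst.
  have v1 := lt_trans hu v0.
  apply: (@cvgV R); first by rewrite gt_eqF// sqrtr_gt0 addr_gt0.
  apply: (@continuous_comp _ _ _ (fun v => v + s) Num.sqrt).
    by apply: cvgD; [exact: cvg_id|exact: cvg_cst].
  exact: sqrt_continuous.
- apply: (integrable_gamma_weightM _ _ (Num.sqrt (u / 2))^-1) => //.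
    by move=> s _; exact: cvg_cst.
  by move=> s _; rewrite ger0_norm// invr_ge0 sqrtr_ge0.
- move=> v /=; rewrite in_itv/= => /andP[v0 _].
  apply: aeW => s /=; rewrite in_itv/= andbT => s0.
  rewrite normrM (gtr0_norm (gamma_weight_gt0 _ _ s0)).
  rewrite ler_pM2l ?gamma_weight_gt0//.
  apply: (le_trans (sqrtVD_le _ _ (lt_trans hu v0) s0)).
  by rewrite lef_pV2 ?posrE ?sqrtr_gt0 ?(lt_trans hu v0)// ler_wsqrtr// ltW.
- by rewrite inE/= in_itv/= ltrDl ltr01 andbT ltr_pdivrMr// ltr_pMr// ltr1n.
Qed.
End invsqrt.

(** * Pointwise bounds and convexity in the square of the variable *)

Section convexity.
Context {R : realType}.
Implicit Types a b q s u v w x y : R.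
Local Notation mu := (@lebesgue_measure R).
Local Notation J := invsqrt_integral.

(** Both sides are compared through the tangent to the exponential at the
    weighted mean of the logarithms. *)
Lemma powR_AMGM_lt x y w : 0 < x -> 0 < y -> x != y -> 0 < w < 1 ->
  x `^ w * y `^ (1 - w) < w * x + (1 - w) * y.
Proof.
move=> x0 y0 xy /andP[w0 w1].
pose m := w * ln x + (1 - w) * ln y.
have -> : x `^ w * y `^ (1 - w) = expR m by rewrite /powR !gt_eqF// -expRD.
have E z : 0 < z -> z = expR m * expR (ln z - m).
  by move=> z0; rewrite -expRD addrC subrK lnK.
rewrite [in ltRHS](E x x0) [in ltRHS](E y y0).
rewrite !(mulrCA _ (expR m)) -mulrDr -[ltLHS]mulr1 ltr_pM2l ?expR_gt0//.
have lxy : ln x - ln y != 0 by rewrite subr_eq0; apply: contra xy => /eqP /ln_inj ->.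
have xm : ln x - m != 0.
  have -> : ln x - m = (1 - w) * (ln x - ln y) by rewrite /m; ring.
  by rewrite mulf_neq0// gt_eqF// subr_gt0.
rewrite [ltLHS](_ : 1 = w * (1 + (ln x - m)) + (1 - w) * (1 + (ln y - m))); last by rewrite /m; ring.
apply: ltr_leD; first by rewrite ltr_pM2l// expR_gt1Dx.
by rewrite ler_pM2l ?subr_gt0// expR_ge1Dx.
Qed.

Lemma powR_AMGM x y w : 0 < x -> 0 < y -> 0 < w < 1 ->
  x `^ w * y `^ (1 - w) <= w * x + (1 - w) * y.
Proof.
move=> x0 y0 w01; have [->|xy] := eqVneq x y; last by apply: ltW; exact: powR_AMGM_lt.
rewrite -powRD ?(gt_eqF y0) ?implybT//.
have -> : w + (1 - w) = 1 by ring.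
by rewrite (powRr1 (ltW y0)) -mulrDl subrKC mul1r.
Qed.

(** The form used in proofs of Hoelder's inequality, with [a] and [b] the
    integrals of the functions whose values are [x] and [y]. *)
Lemma powR_AMGM_scaled a b x y w : 0 < a -> 0 < b -> 0 < x -> 0 < y ->
  0 < w < 1 ->
  x `^ w * y `^ (1 - w) <=
  a `^ w * b `^ (1 - w) * (w * (x / a) + (1 - w) * (y / b)).
Proof.
move=> a0 b0 x0 y0 w01.
have split (c d p : R) : 0 < c -> 0 < d -> c `^ p = d `^ p * (c / d) `^ p.
  by move=> c0 d0; rewrite -powRM ?(ltW d0) ?(ltW (divr_gt0 c0 d0))// mulrC divfK// gt_eqF.
rewrite (split x a w x0 a0) (split y b (1 - w) y0 b0) mulrACA.
rewrite ler_pM2l; last by rewrite mulr_gt0// powR_gt0.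
by apply: powR_AMGM => //; rewrite divr_gt0.
Qed.

Lemma invsqrt_integral_log_convex q u v w : -1 < q -> 0 < u -> 0 < v -> u != v -> 0 < w < 1 ->
  J q (w * u + (1 - w) * v) < J q u `^ w * J q v `^ (1 - w).
Proof.
move=> q1 u0 v0 uv /[dup] w01 /andP[w0 w1].
have m0 : 0 < w * u + (1 - w) * v by rewrite addr_gt0// mulr_gt0// subr_gt0.
have Ju := invsqrt_integral_gt0 q u q1 u0; have Jv := invsqrt_integral_gt0 q v q1 v0.
set C := J q u `^ w * J q v `^ (1 - w).
have C0 : 0 < C by rewrite mulr_gt0// powR_gt0.
have -> : C = C * w / J q u * J q u + C * (1 - w) / J q v * J q v.
  by field; rewrite !gt_eqF.
pose k z s := gamma_weight q s * (Num.sqrt (z + s))^-1.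
have ik z (c : R) : 0 < z -> mu.-integrable `]0, +oo[ (EFin \o (fun s => c * k z s)).
  by move=> z0; apply: integrable_EFinZl => //; exact: integrable_invsqrt.
have JE z (c : R) : 0 < z -> c * J q z = \int[mu]_(s in `]0, +oo[) (c * k z s).
  by move=> z0; rewrite RintegralZl//; exact: integrable_invsqrt.
rewrite !JE// -RintegralD ?ik// -[J q _]mul1r JE//.
apply: lt_Rintegral_itv0y; first exact: ik.
  by apply: integrable_EFinD => //; exact: ik.
move=> s s0; rewrite mul1r /k.
rewrite !(mulrCA _ (gamma_weight q s)) -mulrDr ltr_pM2l ?gamma_weight_gt0//.
have us : 0 < u + s by rewrite addr_gt0.
have vs : 0 < v + s by rewrite addr_gt0.
have ms : 0 < w * u + (1 - w) * v + s by rewrite addr_gt0.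
have uvs : 0 < (u + s) `^ w * (v + s) `^ (1 - w) by rewrite mulr_gt0// powR_gt0.
have sV z : 0 < z -> (Num.sqrt z)^-1 = z `^ (- 2^-1).
  by move=> z0; rewrite powRN powR12_sqrt// ltW.
set a := (Num.sqrt (u + s))^-1; set b := (Num.sqrt (v + s))^-1.
have a0 : 0 < a by rewrite invr_gt0 sqrtr_gt0.
have b0 : 0 < b by rewrite invr_gt0 sqrtr_gt0.
(* strictness comes from the kernels; the second comparison may be an equality *)
apply: (@lt_le_trans _ _ (a `^ w * b `^ (1 - w))).
  rewrite /a /b !sV// 2!(powRAC _ (- 2^-1)) -powRM ?powR_ge0// -!sV//.
  rewrite ltf_pV2 ?posrE ?sqrtr_gt0// ltr_sqrt//.
  have -> : w * u + (1 - w) * v + s = w * (u + s) + (1 - w) * (v + s) by ring.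
  by apply: powR_AMGM_lt => //; apply: contra uv => /eqP /addIr ->.
have -> : C * w / J q u * a + C * (1 - w) / J q v * b =
  C * (w * (a / J q u) + (1 - w) * (b / J q v)) by ring.
exact: powR_AMGM_scaled.
Qed.

(** In terms of [t = 1 / x], the right-hand side is the tangent at [t = 1 / m] to
    the concave function [t |-> (t^(-2) + s)^(-1/2)]. *)
Lemma tangent_sqrtV x m s : 0 < x -> 0 < m -> 0 < s -> x != m ->
  (Num.sqrt (x ^+ 2 + s))^-1 < (s + m ^+ 3 / x) / Num.sqrt (m ^+ 2 + s) ^+ 3.
Proof.
move=> x0 m0 s0 xm.
have a0 : 0 < x ^+ 2 + s by rewrite addr_gt0 ?exprn_gt0.
have b0 : 0 < m ^+ 2 + s by rewrite addr_gt0 ?exprn_gt0.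
rewrite -[ltLHS]mul1r ltr_pdivrMr ?sqrtr_gt0// mulrAC ltr_pdivlMr ?exprn_gt0 ?sqrtr_gt0//.
rewrite mul1r -(ltr_pM2l x0).
have -> : x * ((s + m ^+ 3 / x) * Num.sqrt (x ^+ 2 + s)) =
  (s * x + m ^+ 3) * Num.sqrt (x ^+ 2 + s) by field; rewrite gt_eqF.
(* after squaring, the difference is a positive multiple of (x - m) ^+ 2 *)
rewrite -ltr_sqr ?nnegrE; last 2 first.
- by rewrite mulr_ge0 ?exprn_ge0 ?sqrtr_ge0 ?(ltW x0).
- by rewrite mulr_ge0 ?sqrtr_ge0// addr_ge0 ?mulr_ge0 ?exprn_ge0 ?ltW.
rewrite (exprMn 2 x) (exprMn 2 (s * x + _)) [_ ^+ 3 ^+ 2]exprAC !sqr_sqrtr ?ltW// -subr_gt0.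
have -> : (s * x + m ^+ 3) ^+ 2 * (x ^+ 2 + s) - x ^+ 2 * (m ^+ 2 + s) ^+ 3 =
  (s ^+ 2 * x * (x + 2 * m) + s * m ^+ 3 * (2 * x + m)) * (x - m) ^+ 2 by ring.
rewrite mulr_gt0//.
- by rewrite addr_gt0 ?mulr_gt0 ?addr_gt0 ?exprn_gt0 ?mulr_gt0.
- by rewrite exprn_even_gt0//= subr_eq0.
Qed.
End convexity.

(** * Concavity *)

Section concavity.
Context {R : realType}.
Implicit Types q s u v w x y : R.
Local Notation mu := (@lebesgue_measure R).
Local Notation J := invsqrt_integral.

(** The tangent at the weighted harmonic mean [m] is affine in the reciprocal of
    the variable, so its values at [x] and [y] average to its value at [m]. *)
Lemma invsqrt_integral_harmonic_concave q x y w : -1 < q -> 0 < x -> 0 < y -> x != y -> 0 < w < 1 ->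
  w * J q (x ^+ 2) + (1 - w) * J q (y ^+ 2) <
  J q ((w / x + (1 - w) / y)^-1 ^+ 2).
Proof.
move=> q1 x0 y0 xy /andP[w0 w1].
have w1' : 0 < 1 - w by rewrite subr_gt0.
set m := (_ + _)^-1.
have m0 : 0 < m by rewrite invr_gt0 addr_gt0// divr_gt0.
have mE : m^-1 = w / x + (1 - w) / y by rewrite invrK.
have xyV : x^-1 - y^-1 != 0.
  by rewrite subr_eq0; apply: contra xy => /eqP/invr_inj ->.
have xm : x != m.
  apply: contra xyV => /eqP xm; move: mE; rewrite -xm => xE.
  have : (1 - w) * (x^-1 - y^-1) = 0.
    by rewrite (_ : _ * _ = x^-1 - (w / x + (1 - w) / y)); [rewrite -xE subrr|ring].
  by move/eqP; rewrite mulf_eq0 gt_eqF.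
have ym : y != m.
  apply: contra xyV => /eqP ym; move: mE; rewrite -ym => yE.
  have : w * (x^-1 - y^-1) = 0.
    by rewrite (_ : _ * _ = (w / x + (1 - w) / y) - y^-1); [rewrite -yE subrr|ring].
  by move/eqP; rewrite mulf_eq0 gt_eqF.
have ik z (c : R) : 0 < z -> mu.-integrable `]0, +oo[ (EFin \o (fun s => c * (gamma_weight q s * (Num.sqrt (z ^+ 2 + s))^-1))).
  move=> z0; apply: integrable_EFinZl => //; apply: integrable_invsqrt => //.
  by rewrite exprn_gt0.
rewrite /J -!RintegralZl ?integrable_invsqrt ?exprn_gt0// -RintegralD ?ik//.
apply: lt_Rintegral_itv0y.
- by apply: integrable_EFinD => //; exact: ik.
- by apply: integrable_invsqrt; rewrite ?exprn_gt0.
move=> s s0; rewrite !(mulrCA _ (gamma_weight q s)) -mulrDr ltr_pM2l ?gamma_weight_gt0//.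
have ms : 0 < m ^+ 2 + s by rewrite addr_gt0// exprn_gt0.
have -> : (Num.sqrt (m ^+ 2 + s))^-1 =
  w * ((s + m ^+ 3 / x) / Num.sqrt (m ^+ 2 + s) ^+ 3) +
  (1 - w) * ((s + m ^+ 3 / y) / Num.sqrt (m ^+ 2 + s) ^+ 3).
  transitivity ((s + m ^+ 3 * (w / x + (1 - w) / y)) / Num.sqrt (m ^+ 2 + s) ^+ 3); last by ring.
  rewrite -mE.
  have -> : s + m ^+ 3 * m^-1 = Num.sqrt (m ^+ 2 + s) ^+ 2.
    by rewrite sqr_sqrtr ?ltW//; field; rewrite gt_eqF.
  by field; rewrite gt_eqF ?sqrtr_gt0.
by apply: ltrD; rewrite ltr_pM2l//; exact: tangent_sqrtV.
Qed.

Lemma integrable_expR_invsqrt q a v : -1 < q -> 1 < a -> 0 < v ->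
  mu.-integrable `]0, +oo[ (EFin \o (fun s =>
    gamma_weight q s * (expR (- ((a - 1) * s)) * (Num.sqrt (v + s))^-1))).
Proof.
move=> q1 a1 v0; apply: (integrable_gamma_weightM _ _ (Num.sqrt v)^-1) => //.
  move=> s s0; apply: (@cvgM R); last exact: continuous_sqrtVD.
  apply: (@continuous_comp _ _ _ (fun s : R => - ((a - 1) * s)) expR).
    by apply: cvgN; apply: (@cvgM R); [exact: cvg_cst|exact: cvg_id].
  exact: continuous_expR.
move=> s s0; rewrite normrM (gtr0_norm (expR_gt0 _)) -[leRHS]mul1r.
rewrite ler_pM ?sqrtVD_le ?expR_ge0//.
by rewrite expR_le1 oppr_le0 mulr_ge0 ?subr_ge0 ?ltW.
Qed.

(** The substitution [s |-> a s]; the factor [expR (- (a * s))] is split as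
    [expR (- s)], which belongs to the weight, times [expR (- ((a - 1) * s))]. *)
Lemma invsqrt_integral_scale q a v : -1 < q -> 1 < a -> 0 < v ->
  J q (a * v) = a `^ q * Num.sqrt a *
    \int[mu]_(s in `]0, +oo[)
      (gamma_weight q s * (expR (- ((a - 1) * s)) * (Num.sqrt (v + s))^-1)).
Proof.
move=> q1 a1 v0; have a0 : 0 < a by lra.
have av0 : 0 < a * v by rewrite mulr_gt0.
pose G (t : R) := gamma_weight q t * (Num.sqrt (a * v + t))^-1.
have dF s : 0 < s -> is_derive s 1 (fun s : R => a * s) a.
  move=> s0; have := is_deriveZ a (is_derive_id s 1).
  by rewrite /GRing.scale/= mulr1.
have Finc : {in `[0, +oo[ &, {homo (fun s : R => a * s) : s t / s < t}}.
  by move=> s t _ _ st; rewrite ltr_pM2l.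
have cF : continuous (fun s : R => a * s).
  by move=> s; apply: cvgMl_tmp; exact: cvg_id.
have H := @integration_by_substitution_itvoy R (fun s => a * s) (cst a) G 0 Finc dF.
rewrite /J [LHS](_ : _ = fine (\int[mu]_(t in `](a * 0)%R, +oo[) (G t)%:E)%E); last by rewrite mulr0.
rewrite H.
- rewrite -RintegralZl//; last exact: integrable_expR_invsqrt.
  congr fine; apply: eq_integral => s; rewrite inE/= in_itv/= andbT => s0; congr EFin.
  rewrite /G /gamma_weight -mulrDr powRM ?(ltW a0) ?(ltW s0)// sqrtrM ?(ltW a0)//.
  have -> : - (a * s) = - s + - ((a - 1) * s) by ring.
  rewrite expRD [X in _ * X = _](_ : _ = Num.sqrt a ^+ 2); last by rewrite sqr_sqrtr ?(ltW a0).
  by field; rewrite !gt_eqF ?sqrtr_gt0 ?addr_gt0.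
- by move=> s _; exact: cvg_cst.
- exact: is_cvg_cst.
- by apply: cvg_at_right_filter; exact: cF.
- by apply: gt0_cvgMry => //; exact: cvg_id.
- rewrite mulr0 => t t0; apply: (@cvgM R); first exact: continuous_gamma_weight.
  exact: continuous_sqrtVD.
- move=> t; rewrite mulr0 => t0; rewrite mulr_ge0 ?invr_ge0 ?sqrtr_ge0//.
  exact: ltW (gamma_weight_gt0 _ _ _).
Qed.

(** Chebyshev's association inequality, proved with single integrals: [e] and
    the ratio of the two kernels are monotone in opposite directions, so
    replacing the ratio by its value where [e] crosses its mean [theta] can only
    increase the integral of [(e - theta)] times the ratio. *)
Lemma invsqrt_integral_mul_lt q u a b : -1 < q -> 0 < u -> 1 < a -> 1 < b ->
  J q u * J q (a * (b * u)) < J q (a * u) * J q (b * u).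
Proof.
move=> q1 u0 a1 b1.
have a0 : 0 < a by lra.
have b0 : 0 < b by lra.
have bu0 : 0 < b * u by rewrite mulr_gt0.
pose e s := expR (- ((a - 1) * s)).
pose k v s := gamma_weight q s * (Num.sqrt (v + s))^-1.
pose P v := \int[mu]_(s in `]0, +oo[) (gamma_weight q s * (e s * (Num.sqrt (v + s))^-1)).
have e0 s : 0 < e s by exact: expR_gt0.
have e1 s : 0 < s -> e s < 1.
  by move=> s0; rewrite /e expR_lt1 oppr_lt0 mulr_gt0// subr_gt0.
have ik v : 0 < v -> mu.-integrable `]0, +oo[ (EFin \o (k v)) by exact: integrable_invsqrt.
have iP v : 0 < v -> mu.-integrable `]0, +oo[
    (EFin \o (fun s => gamma_weight q s * (e s * (Num.sqrt (v + s))^-1))).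
  by move=> v0; exact: integrable_expR_invsqrt.
have Ju := invsqrt_integral_gt0 q u q1 u0.
have P0 : 0 < P u.
  apply: Rintegral_itv0y_gt0; first exact: iP.
  move=> s s0; apply: mulr_gt0; first exact: gamma_weight_gt0.
  by apply: mulr_gt0 => //; rewrite invr_gt0 sqrtr_gt0 addr_gt0.
have PJ : P u < J q u.
  apply: lt_Rintegral_itv0y; [exact: iP|exact: ik|move=> s s0].
  rewrite ltr_pM2l ?gamma_weight_gt0// gtr_pMl ?e1//.
  by rewrite invr_gt0 sqrtr_gt0 addr_gt0.
pose theta := P u / J q u.
have th0 : 0 < theta by rewrite divr_gt0.
have th1 : theta < 1 by rewrite ltr_pdivrMr// mul1r.
(* c is the point where e crosses its mean value theta *)
pose c := - ln theta / (a - 1).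
have c0 : 0 < c by rewrite divr_gt0 ?subr_gt0// oppr_gt0 ln_lt0// th0.
have ec : e c = theta.
  by rewrite /e /c mulrC divfK ?subr_eq0 ?gt_eqF// opprK lnK// posrE.
have e_lt s t : s < t -> e t < e s.
  by move=> st; rewrite /e ltr_expR ltrN2 ltr_pM2l// subr_gt0.
pose r := Num.sqrt (u + c) / Num.sqrt (b * u + c).
have r_lt s t : 0 < s -> s < t ->
   Num.sqrt (u + s) / Num.sqrt (b * u + s) < Num.sqrt (u + t) / Num.sqrt (b * u + t).
  move=> s0 st; have t0 := lt_trans s0 st.
  have pos z1 z2 : 0 < z1 -> 0 < z2 -> 0 < Num.sqrt (z1 + z2).
    by move=> ? ?; rewrite sqrtr_gt0 addr_gt0.
  rewrite ltr_pdivrMr ?pos// mulrAC ltr_pdivlMr ?pos//.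
  rewrite -!sqrtrM ?addr_ge0 ?(ltW u0) ?(ltW s0) ?(ltW t0)//.
  rewrite ltr_sqrt ?mulr_gt0 ?addr_gt0//.
  rewrite -subr_gt0 (_ : _ - _ = u * ((b - 1) * (t - s))); last by ring.
  by rewrite !mulr_gt0// subr_gt0.
have key : P (b * u) - theta * J q (b * u) < 0.
  have -> : 0 = r * (P u - theta * J q u).
    by rewrite /theta divfK ?gt_eqF// subrr mulr0.
  rewrite /P /J -!RintegralZl ?ik// -!RintegralB ?iP ?integrable_EFinZl ?ik//.
  rewrite -RintegralZl//; last first.
    by apply: integrable_EFinB; rewrite ?integrable_EFinZl ?ik ?iP.
  have E v s : gamma_weight q s * (e s / Num.sqrt (v + s)) -
    theta * (gamma_weight q s / Num.sqrt (v + s)) =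
    gamma_weight q s * ((e s - theta) * (Num.sqrt (v + s))^-1) by ring.
  have rE s : 0 < s -> (Num.sqrt (b * u + s))^-1 =
    (Num.sqrt (u + s) / Num.sqrt (b * u + s)) * (Num.sqrt (u + s))^-1.
    by move=> s0; rewrite mulrAC divff ?mul1r// gt_eqF// sqrtr_gt0 addr_gt0.
  apply: (lt_Rintegral_itv0y_near0 _ _ c) => //.
  - by apply: integrable_EFinB; rewrite ?integrable_EFinZl ?ik ?iP.
  - by apply: integrable_EFinZl => //; apply: integrable_EFinB;
      rewrite ?integrable_EFinZl ?ik ?iP.
  - move=> s s0; rewrite !E [leRHS]mulrCA ler_pM2l ?gamma_weight_gt0// rE// [leLHS]mulrCA.
    rewrite !mulrA ler_pM2r ?invr_gt0 ?sqrtr_gt0 ?addr_gt0//.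
    have [sc|cs|->] := ltgtP s c; last by rewrite lexx.
    + rewrite ler_pM2r; first by apply: ltW; exact: r_lt.
      by rewrite subr_gt0 -ec e_lt.
    + rewrite ler_nM2r; first by apply: ltW; exact: r_lt.
      by rewrite subr_lt0 -ec e_lt.
  - move=> s /andP[s0 sc]; rewrite !E [ltRHS]mulrCA ltr_pM2l ?gamma_weight_gt0// rE// [ltLHS]mulrCA.
    rewrite !mulrA ltr_pM2r ?invr_gt0 ?sqrtr_gt0 ?addr_gt0//.
    by rewrite ltr_pM2r ?r_lt// subr_gt0 -ec e_lt.
rewrite !(invsqrt_integral_scale q a)// mulrCA -!mulrA ltr_pM2l ?powR_gt0// ltr_pM2l ?sqrtr_gt0//.
rewrite -/(P u) -/(P (b * u)) -ltr_pdivlMl// mulrA -subr_lt0.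
by rewrite [_^-1 * _]mulrC.
Qed.

(** Otherwise the gap between [f] and its chord, which vanishes at both ends,
    would attain its minimum over the segment at an interior point, where the
    strict midpoint inequality on a small symmetric interval contradicts
    minimality. *)
Lemma midpoint_strict_concave (f : R -> R) : continuous f ->
  (forall x y, x != y -> f x + f y < 2 * f ((x + y) / 2)) ->
  forall x y w, x != y -> 0 < w < 1 ->
  w * f x + (1 - w) * f y < f (w * x + (1 - w) * y).
Proof.
move=> cf mid x y w xy /andP[w0 w1].
pose g (t : R) := f (t * x + (1 - t) * y) - (t * f x + (1 - t) * f y).
have cg : continuous g.
  move=> t; have cl : continuous (fun t : R => t * x + (1 - t) * y).
    move=> t'; apply: cvgD; apply: cvgMr_tmp; first exact: cvg_id.
    by apply: cvgB; [exact: cvg_cst|exact: cvg_id].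
  apply: cvgB; first exact: (@continuous_comp _ _ _ (fun t : R => t * x + (1 - t) * y) f t (cl t) (cf _)).
  apply: cvgD; apply: cvgMr_tmp; first exact: cvg_id.
  by apply: cvgB; [exact: cvg_cst|exact: cvg_id].
have gmid s t : s != t -> g s + g t < 2 * g ((s + t) / 2).
  move=> st; rewrite /g.
  have := mid (s * x + (1 - s) * y) (t * x + (1 - t) * y).
  have -> : (s * x + (1 - s) * y + (t * x + (1 - t) * y)) / 2 =
    (s + t) / 2 * x + (1 - (s + t) / 2) * y by field.
  have -> : s * x + (1 - s) * y != t * x + (1 - t) * y.
    rewrite -subr_eq0 (_ : _ - _ = (s - t) * (x - y)); last by ring.
    by rewrite mulf_neq0// subr_eq0.
  by move=> /(_ isT) h; lra.
have g0 : g 0 = 0 by rewrite /g !mul0r !add0r subr0 !mul1r subrr.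
have g1 : g 1 = 0 by rewrite /g subrr !mul0r !addr0 !mul1r subrr.
have [c /[!in_itv]/= c01 gc] := @EVT_min R g 0 1 ler01 (continuous_subspaceT cg).
have noint t : 0 < t < 1 -> ~ (forall s, s \in `[0, 1] -> g t <= g s).
  move=> /andP[t0 t1] gt.
  pose h := Num.min t (1 - t).
  have h0 : 0 < h by rewrite lt_min t0 subr_gt0.
  have ht : h <= t by rewrite ge_min lexx.
  have ht1 : h <= 1 - t by rewrite ge_min lexx orbT.
  have := gmid (t - h) (t + h).
  have -> : t - h != t + h by rewrite lt_eqF//; lra.
  have -> : (t - h + (t + h)) / 2 = t by field.
  move=> /(_ isT).
  have := gt (t - h); have := gt (t + h); rewrite !in_itv/=.
  have -> : 0 <= t - h <= 1 by apply/andP; split; lra.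
  have -> : 0 <= t + h <= 1 by apply/andP; split; lra.
  by move=> /(_ isT) + /(_ isT); lra.
have gc0 : g c = 0.
  have /andP[+ +] := c01; rewrite !le_eqVlt => /predU1P[<-//|c0] /predU1P[->//|c1].
  by case: (noint c _ gc); rewrite c0.
rewrite -subr_gt0 -/(g w) lt_neqAle -{2}gc0 gc ?in_itv/= ?(ltW w0) ?(ltW w1)// andbT.
apply/negP => /eqP gw; apply: (noint w); first by rewrite w0.
by move=> s /gc; rewrite gc0 gw.
Qed.

(** For [x < y], the points [expR x] and [expR y] are [u] and [a * (a * u)], with
    geometric mean [a * u], for [u = expR x] and [a = expR ((y - x) / 2) > 1]. *)
Lemma invsqrt_integral_geometric_concave q u v w : -1 < q -> 0 < u -> 0 < v -> u != v ->
  0 < w < 1 -> J q u `^ w * J q v `^ (1 - w) < J q (u `^ w * v `^ (1 - w)).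
Proof.
move=> q1 u0 v0 uv w01.
pose f (t : R) : R := ln (J q (expR t)).
have Jexp t : 0 < J q (expR t) by apply: invsqrt_integral_gt0; rewrite ?expR_gt0.
have cf : continuous f.
  move=> t; apply: (@continuous_comp _ _ _ (fun t : R => J q (expR t)) (@ln R)).
    apply: continuous_comp; first exact: continuous_expR.
    by apply: continuous_invsqrt_integral => //; rewrite in_itv/= expR_gt0.
  exact: continuous_ln.
have mid_lt x y : x < y -> f x + f y < 2 * f ((x + y) / 2).
  move=> xy; pose a := expR ((y - x) / 2).
  have a1 : 1 < a by rewrite expR_gt1 divr_gt0// subr_gt0.
  have := invsqrt_integral_mul_lt q (expR x) a a q1 (expR_gt0 x) a1 a1.
  rewrite /a -!expRD.
  have -> : (y - x) / 2 + x = (x + y) / 2 by field.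
  have -> : (y - x) / 2 + (x + y) / 2 = y by field.
  move=> h; rewrite /f -lnM ?posrE// (_ : 2 * _ = ln (J q (expR ((x + y) / 2)) * J q (expR ((x + y) / 2)))).
    by rewrite ltr_ln ?posrE ?mulr_gt0.
  by rewrite lnM ?posrE// mulr2n mulrDl !mul1r.
have mid x y : x != y -> f x + f y < 2 * f ((x + y) / 2).
  have [xy _|yx _|->] := ltgtP x y; last by [].
    exact: mid_lt.
  by rewrite addrC (addrC x); exact: mid_lt.
have lnuv : ln u != ln v by apply: contra uv => /eqP/ln_inj ->.
have := midpoint_strict_concave f cf mid _ _ _ lnuv w01; rewrite /f.
have m0 : 0 < u `^ w * v `^ (1 - w) by rewrite mulr_gt0// powR_gt0.
have -> : expR (w * ln u + (1 - w) * ln v) = u `^ w * v `^ (1 - w).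
  by rewrite expRD /powR !gt_eqF.
have Ju := invsqrt_integral_gt0 q u q1 u0; have Jv := invsqrt_integral_gt0 q v q1 v0.
have Jw := powR_gt0 w Ju; have Jw' := powR_gt0 (1 - w) Jv.
rewrite (lnK u0) (lnK v0) => h.
rewrite -ltr_ln ?posrE ?(mulr_gt0 Jw Jw') ?(invsqrt_integral_gt0 _ _ q1 m0)//.
by rewrite (lnM Jw Jw'); move: h; rewrite -(ln_powR (J q u) w) -(ln_powR (J q v) (1 - w)).
Qed.
End concavity.

(** * Power means *)

Section power_mean.
Context {R : realType}.
Implicit Types a b w x y : R.

Lemma powRK a x : a != 0 -> 0 < x -> (x `^ a) `^ a^-1 = x.
Proof. by move=> a0 x0; rewrite -powRrM divff// powRr1// ltW. Qed.

Lemma power_mean_id w a x : 0 < x -> power_mean w a x x = x.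
Proof.
move=> x0; rewrite /power_mean; case: ifPn => a0.
  rewrite -powRD ?(gt_eqF x0) ?implybT//.
  by rewrite (_ : w + (1 - w) = 1); [rewrite powRr1// ltW|ring].
rewrite (_ : w * _ + _ = x `^ a); last by ring.
exact: powRK.
Qed.

Lemma power_mean_w0 a x y : 0 < y -> power_mean 0 a x y = y.
Proof.
move=> y0; rewrite /power_mean subr0; case: ifPn => a0.
  by rewrite powRr0 mul1r powRr1// ltW.
by rewrite mul0r add0r mul1r powRK.
Qed.

Lemma power_mean_w1 a x y : 0 < x -> power_mean 1 a x y = x.
Proof.
move=> x0; rewrite /power_mean subrr; case: ifPn => a0.
  by rewrite powRr0 mulr1 powRr1// ltW.
by rewrite mul0r addr0 mul1r powRK.
Qed.

Lemma power_mean_degenerate a b (f : R -> R) w x y :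
  0 < x -> 0 < y -> 0 < f x -> 0 < f y ->
  [|| x == y, w == 0 | w == 1] ->
  f (power_mean w a x y) = power_mean w b (f x) (f y).
Proof.
move=> x0 y0 fx0 fy0 /or3P[] /eqP ->.
- by rewrite !power_mean_id.
- by rewrite !power_mean_w0.
- by rewrite !power_mean_w1.
Qed.

Lemma nondegenerate_weight x y w : 0 <= w <= 1 ->
  [|| x == y, w == 0 | w == 1] \/ x != y /\ 0 < w < 1.
Proof.
move=> /andP[w0 w1]; have [_|xy] := eqVneq x y; first by left.
have [_|nw0] := eqVneq w 0; first by left.
have [_|nw1] := eqVneq w 1; first by left.
by right; rewrite !lt_neqAle nw1 w0 w1 eq_sym nw0.
Qed.

(** The strict inequality covers every case except those in which both means
    reduce to one of their arguments; there equality holds. *)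
Lemma strictly_mean_convex_intro (a b : R) (f : R -> R) :
  positive_continuous_on `]0, +oo[ f ->
  (forall x y w, 0 < x -> 0 < y -> x != y -> 0 < w < 1 ->
    f (power_mean w a x y) < power_mean w b (f x) (f y)) ->
  strictly_mean_convex `]0, +oo[ a b f.
Proof.
move=> fpc flt; have [_ f0 _] := fpc.
split; last by move=> x y w; rewrite !in_itv/= !andbT; exact: flt.
split=> // x y w /[dup] xI + /[dup] yI; rewrite !in_itv/= !andbT => x0 y0 w01.
have [deg|[xy w01']] := nondegenerate_weight x y w w01; last exact/ltW/flt.
by rewrite (power_mean_degenerate a b) ?f0.
Qed.

Lemma strictly_mean_concave_intro (a b : R) (f : R -> R) :
  positive_continuous_on `]0, +oo[ f ->
  (forall x y w, 0 < x -> 0 < y -> x != y -> 0 < w < 1 ->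
    power_mean w b (f x) (f y) < f (power_mean w a x y)) ->
  strictly_mean_concave `]0, +oo[ a b f.
Proof.
move=> fpc flt; have [_ f0 _] := fpc.
split; last by move=> x y w; rewrite !in_itv/= !andbT; exact: flt.
split=> // x y w /[dup] xI + /[dup] yI; rewrite !in_itv/= !andbT => x0 y0 w01.
have [deg|[xy w01']] := nondegenerate_weight x y w w01; last exact/ltW/flt.
by rewrite (power_mean_degenerate a b) ?f0.
Qed.

Lemma strictly_mean_convex_half (a b : R) (f : R -> R) x y :
  strictly_mean_convex `]0, +oo[ a b f -> 0 < x -> 0 < y ->
  f (power_mean 2^-1 a x y) <= power_mean 2^-1 b (f x) (f y) /\
  (f (power_mean 2^-1 a x y) = power_mean 2^-1 b (f x) (f y) <-> x = y).
Proof.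
move=> [[[_ f0 _] fle] flt] x0 y0.
have xI : x \in `]0, +oo[ by rewrite in_itv/= andbT.
have yI : y \in `]0, +oo[ by rewrite in_itv/= andbT.
split; first by apply: fle => //; apply/andP; split; lra.
split=> [fxy|xy]; last by apply: power_mean_degenerate; rewrite ?f0 ?xy ?eqxx.
apply/eqP; apply/negPn/negP => xy.
have := flt x y 2^-1 xI yI xy; rewrite fxy ltxx => h.
by suff : false by []; apply: h; apply/andP; split; lra.
Qed.

Lemma strictly_mean_concave_half (a b : R) (f : R -> R) x y :
  strictly_mean_concave `]0, +oo[ a b f -> 0 < x -> 0 < y ->
  power_mean 2^-1 b (f x) (f y) <= f (power_mean 2^-1 a x y) /\
  (power_mean 2^-1 b (f x) (f y) = f (power_mean 2^-1 a x y) <-> x = y).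
Proof.
move=> [[[_ f0 _] fle] flt] x0 y0.
have xI : x \in `]0, +oo[ by rewrite in_itv/= andbT.
have yI : y \in `]0, +oo[ by rewrite in_itv/= andbT.
split; first by apply: fle => //; apply/andP; split; lra.
split=> [fxy|xy]; last by apply/esym/power_mean_degenerate; rewrite ?f0 ?xy ?eqxx.
apply/eqP; apply/negPn/negP => xy.
have := flt x y 2^-1 xI yI xy; rewrite fxy ltxx => h.
by suff : false by []; apply: h; apply/andP; split; lra.
Qed.

Lemma power_mean0E w x y : power_mean w 0 x y = x `^ w * y `^ (1 - w).
Proof. by rewrite /power_mean eqxx. Qed.

Lemma power_mean1E w x y : 0 < x -> 0 < y -> 0 <= w <= 1 ->
  power_mean w 1 x y = w * x + (1 - w) * y.
Proof.
move=> x0 y0 /andP[w0 w1]; rewrite /power_mean oner_eq0 invr1.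
rewrite (powRr1 (ltW x0)) (powRr1 (ltW y0)) powRr1//.
by rewrite addr_ge0// mulr_ge0 ?subr_ge0// ltW.
Qed.

Lemma power_meanN1E w x y : 0 < x -> 0 < y -> 0 <= w <= 1 ->
  power_mean w (-1) x y = (w / x + (1 - w) / y)^-1.
Proof.
move=> x0 y0 /andP[w0 w1]; rewrite /power_mean oppr_eq0 oner_eq0 invrN1.
rewrite (powR_inv1 (ltW x0)) (powR_inv1 (ltW y0)) powR_inv1//.
by rewrite addr_ge0// divr_ge0 ?subr_ge0// ltW.
Qed.

Lemma power_mean2E w x y : 0 < x -> 0 < y -> 0 <= w <= 1 ->
  power_mean w 2 x y = Num.sqrt (w * x ^+ 2 + (1 - w) * y ^+ 2).
Proof.
move=> x0 y0 /andP[w0 w1]; rewrite /power_mean pnatr_eq0/=.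
rewrite (powR_mulrn 2 (ltW x0)) (powR_mulrn 2 (ltW y0)) powR12_sqrt//.
by rewrite addr_ge0// mulr_ge0 ?subr_ge0 ?exprn_ge0// ltW.
Qed.

End power_mean.

Section half_means.
Context {R : realType}.
Implicit Types x y : R.

Let half01 : 0 <= (2^-1 : R) <= 1. Proof. by apply/andP; split; lra. Qed.
Let subhalf : 1 - 2^-1 = 2^-1 :> R. Proof. by lra. Qed.

Lemma power_mean_half0 x y : 0 < x -> 0 < y ->
  power_mean 2^-1 0 x y = Num.sqrt (x * y).
Proof.
by move=> x0 y0; rewrite power_mean0E subhalf -powRM ?ltW// powR12_sqrt// mulr_ge0// ltW.
Qed.

Lemma power_mean_half1 x y : 0 < x -> 0 < y ->
  power_mean 2^-1 1 x y = (x + y) / 2.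
Proof. by move=> x0 y0; rewrite power_mean1E// subhalf; field. Qed.

Lemma power_mean_half2 x y : 0 < x -> 0 < y ->
  power_mean 2^-1 2 x y = Num.sqrt ((x ^+ 2 + y ^+ 2) / 2).
Proof.
by move=> x0 y0; rewrite power_mean2E// subhalf; congr Num.sqrt; field.
Qed.

Lemma power_mean_halfN1 x y : 0 < x -> 0 < y ->
  power_mean 2^-1 (-1) x y = 2 * x * y / (x + y).
Proof.
move=> x0 y0; rewrite power_meanN1E// subhalf; field.
by rewrite !gt_eqF ?addr_gt0// mulr_gt0.
Qed.
End half_means.

(** * Convexity and concavity of V *)

Section V.
Context {R : realType}.
Implicit Types q w x y : R.
Local Notation J := invsqrt_integral.

Lemma V_gt0 q x : -1 < q -> 0 < x -> 0 < V q x.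
Proof.
move=> q1 x0; rewrite V_invsqrt_integral// divr_gt0 ?Gamma_gt0//.
by apply: invsqrt_integral_gt0; rewrite ?exprn_gt0.
Qed.

Lemma V_positive_continuous q : -1 < q -> positive_continuous_on `]0, +oo[ (V q).
Proof.
move=> q1; split.
- by move=> x /=; rewrite in_itv/= andbT.
- by move=> x; rewrite in_itv/= andbT; exact: V_gt0.
- apply: (@subspace_eq_continuous _ _ _ (fun x => J q (x ^+ 2) / Gamma (q + 1))).
    by move=> x; rewrite inE/= in_itv/= andbT => x0; rewrite -V_invsqrt_integral.
  apply: continuous_in_subspaceT => x; rewrite inE/= in_itv/= andbT => x0.
  apply: cvgMr_tmp.
  apply: (@continuous_comp _ _ _ (fun x : R => x ^+ 2) (J q)).
    exact: exprn_continuous.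
  by apply: continuous_invsqrt_integral => //; rewrite in_itv/= andbT exprn_gt0.
Qed.

Lemma powR_mean_div (a b c w : R) : 0 < a -> 0 < b -> 0 < c ->
  (a / c) `^ w * (b / c) `^ (1 - w) = a `^ w * b `^ (1 - w) / c.
Proof.
move=> a0 b0 c0; rewrite !powRM ?invr_ge0 ?ltW// mulrACA; congr (_ * _).
rewrite -powRD ?invr_eq0 ?(gt_eqF c0) ?implybT//.
by rewrite (_ : w + (1 - w) = 1); [rewrite powRr1// invr_ge0 ltW|ring].
Qed.

Lemma sqr_neq x y : 0 < x -> 0 < y -> x != y -> x ^+ 2 != y ^+ 2.
Proof. by move=> x0 y0; rewrite eqrXn2// ltW. Qed.

Lemma V_geometric_concave q : -1 < q -> strictly_mean_concave `]0, +oo[ 0 0 (V q).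
Proof.
move=> q1; apply: strictly_mean_concave_intro; first exact: V_positive_continuous.
move=> x y w x0 y0 xy w01.
have x20 : 0 < x ^+ 2 by rewrite exprn_gt0.
have y20 : 0 < y ^+ 2 by rewrite exprn_gt0.
rewrite !power_mean0E !V_invsqrt_integral//; last by rewrite mulr_gt0// powR_gt0.
have Jx := invsqrt_integral_gt0 q _ q1 x20; have Jy := invsqrt_integral_gt0 q _ q1 y20.
have G0 := Gamma_gt0 q q1.
rewrite (powR_mean_div _ _ _ _ Jx Jy G0) ltr_pM2r ?invr_gt0//.
have -> : (x `^ w * y `^ (1 - w)) ^+ 2 = (x ^+ 2) `^ w * (y ^+ 2) `^ (1 - w).
  by rewrite !expr2 (powRM w (ltW x0) (ltW x0)) (powRM (1 - w) (ltW y0) (ltW y0)) mulrACA.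
by apply: invsqrt_integral_geometric_concave => //; exact: sqr_neq.
Qed.

Lemma V_harmonic_concave q : -1 < q ->
  strictly_mean_concave `]0, +oo[ (-1) 1 (V q).
Proof.
move=> q1; apply: strictly_mean_concave_intro; first exact: V_positive_continuous.
move=> x y w x0 y0 xy /[dup] w01 /andP[w0 w1].
have w01' : 0 <= w <= 1 by rewrite !ltW.
rewrite power_mean1E ?V_gt0// power_meanN1E//.
rewrite !V_invsqrt_integral//; last by rewrite invr_gt0 addr_gt0// divr_gt0// subr_gt0.
rewrite !mulrA -mulrDl ltr_pM2r ?invr_gt0 ?Gamma_gt0//.
exact: invsqrt_integral_harmonic_concave.
Qed.

Lemma V_quadratic_log_convex_lt q x y w : -1 < q -> 0 < x -> 0 < y -> x != y -> 0 < w < 1 ->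
  V q (power_mean w 2 x y) < power_mean w 0 (V q x) (V q y).
Proof.
move=> q1 x0 y0 xy /[dup] w01 /andP[w0 w1].
have w01' : 0 <= w <= 1 by rewrite !ltW.
have x20 : 0 < x ^+ 2 by rewrite exprn_gt0.
have y20 : 0 < y ^+ 2 by rewrite exprn_gt0.
have m0 : 0 < w * x ^+ 2 + (1 - w) * y ^+ 2.
  by rewrite addr_gt0// mulr_gt0// subr_gt0.
rewrite power_mean0E power_mean2E// !V_invsqrt_integral ?sqrtr_gt0// (sqr_sqrtr (ltW m0)).
have Jx := invsqrt_integral_gt0 q _ q1 x20; have Jy := invsqrt_integral_gt0 q _ q1 y20.
have G0 := Gamma_gt0 q q1.
rewrite (powR_mean_div _ _ _ _ Jx Jy G0) ltr_pM2r ?invr_gt0//.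
by apply: invsqrt_integral_log_convex => //; exact: sqr_neq.
Qed.

Lemma V_quadratic_log_convex q : -1 < q -> strictly_mean_convex `]0, +oo[ 2 0 (V q).
Proof.
move=> q1; apply: strictly_mean_convex_intro; first exact: V_positive_continuous.
by move=> x y w x0 y0 xy w01; exact: V_quadratic_log_convex_lt.
Qed.

Lemma V_quadratic_convex q : -1 < q -> strictly_mean_convex `]0, +oo[ 2 1 (V q).
Proof.
move=> q1; apply: strictly_mean_convex_intro; first exact: V_positive_continuous.
move=> x y w x0 y0 xy /[dup] w01 /andP[w0 w1].
apply: lt_le_trans (V_quadratic_log_convex_lt q x y w q1 x0 y0 xy w01) _.
rewrite power_mean0E power_mean1E ?V_gt0 ?(ltW w0) ?(ltW w1)//.
by apply: powR_AMGM => //; exact: V_gt0.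
Qed.
End V.

Theorem theorem2 (R : realType) :
  (* (a) *)
  (forall q : R, -1 < q -> strictly_mean_concave `]0, +oo[ 0 0 (V q)) /\
  (* (b) *)
  (forall q : R, -1 < q -> strictly_mean_concave `]0, +oo[ (-1) 1 (V q)) /\
  (* (c) *)
  (forall q : R, 0 <= q -> strictly_mean_convex `]0, +oo[ 2 1 (V q)) /\
  (* (d) *)
  (forall q : R, 0 <= q -> strictly_mean_convex `]0, +oo[ 2 0 (V q)) /\
  (* inequalities for q >= 0 *)
  (forall q x y : R, 0 <= q -> 0 < x -> 0 < y ->
     [/\ V q (Num.sqrt ((x ^+ 2 + y ^+ 2) / 2)) <= Num.sqrt (V q x * V q y),
         Num.sqrt (V q x * V q y) <= V q (Num.sqrt (x * y))
       & (V q x + V q y) / 2 <= V q (2 * x * y / (x + y))]) /\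
  (* inequalities for q > -1 *)
  (forall q x y : R, -1 < q -> 0 < x -> 0 < y ->
     Num.sqrt (V q x * V q y) <= V q (Num.sqrt (x * y)) /\
     (V q x + V q y) / 2 <= V q (2 * x * y / (x + y))) /\
  (* equality cases *)
  (forall q x y : R, 0 <= q -> 0 < x -> 0 < y ->
     (V q (Num.sqrt ((x ^+ 2 + y ^+ 2) / 2)) = Num.sqrt (V q x * V q y)
      <-> x = y)) /\
  (forall q x y : R, -1 < q -> 0 < x -> 0 < y ->
     (Num.sqrt (V q x * V q y) = V q (Num.sqrt (x * y)) <-> x = y)) /\
  (forall q x y : R, -1 < q -> 0 < x -> 0 < y ->
     ((V q x + V q y) / 2 = V q (2 * x * y / (x + y)) <-> x = y)).
Proof.
have q_gt (q : R) : 0 <= q -> -1 < q by move=> q0; lra.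
have geo (q x y : R) : -1 < q -> 0 < x -> 0 < y ->
    Num.sqrt (V q x * V q y) <= V q (Num.sqrt (x * y)) /\
    (Num.sqrt (V q x * V q y) = V q (Num.sqrt (x * y)) <-> x = y).
  move=> q1 x0 y0.
  have := strictly_mean_concave_half _ _ _ x y (V_geometric_concave q q1) x0 y0.
  rewrite (power_mean_half0 _ _ x0 y0).
  by rewrite (power_mean_half0 _ _ (V_gt0 q x q1 x0) (V_gt0 q y q1 y0)).
have harm (q x y : R) : -1 < q -> 0 < x -> 0 < y ->
    (V q x + V q y) / 2 <= V q (2 * x * y / (x + y)) /\
    ((V q x + V q y) / 2 = V q (2 * x * y / (x + y)) <-> x = y).
  move=> q1 x0 y0.
  have := strictly_mean_concave_half _ _ _ x y (V_harmonic_concave q q1) x0 y0.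
  rewrite (power_mean_halfN1 _ _ x0 y0).
  by rewrite (power_mean_half1 _ _ (V_gt0 q x q1 x0) (V_gt0 q y q1 y0)).
have quad (q x y : R) : 0 <= q -> 0 < x -> 0 < y ->
    V q (Num.sqrt ((x ^+ 2 + y ^+ 2) / 2)) <= Num.sqrt (V q x * V q y) /\
    (V q (Num.sqrt ((x ^+ 2 + y ^+ 2) / 2)) = Num.sqrt (V q x * V q y) <-> x = y).
  move=> /q_gt q1 x0 y0.
  have := strictly_mean_convex_half _ _ _ x y (V_quadratic_log_convex q q1) x0 y0.
  rewrite (power_mean_half2 _ _ x0 y0).
  by rewrite (power_mean_half0 _ _ (V_gt0 q x q1 x0) (V_gt0 q y q1 y0)).
split; first exact: V_geometric_concave.
split; first exact: V_harmonic_concave.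
split; first by move=> q /q_gt; exact: V_quadratic_convex.
split; first by move=> q /q_gt; exact: V_quadratic_log_convex.
split.
  move=> q x y q0 x0 y0; split.
  - by have [] := quad q x y q0 x0 y0.
  - by have [] := geo q x y (q_gt q q0) x0 y0.
  - by have [] := harm q x y (q_gt q q0) x0 y0.
split.
  move=> q x y q1 x0 y0; split.
  - by have [] := geo q x y q1 x0 y0.
  - by have [] := harm q x y q1 x0 y0.
split; first by move=> q x y q0 x0 y0; have [] := quad q x y q0 x0 y0.
split; first by move=> q x y q1 x0 y0; have [] := geo q x y q1 x0 y0.
by move=> q x y q1 x0 y0; have [] := harm q x y q1 x0 y0.
Qed.
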